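(* Suppose that the nonempty matrix family $\mathscr A\subseteq\mathbb R^{n\times n}$ is uniformly exponentially stable and that $\mathcal W\subseteq\mathbb R^n$ is nonempty and bounded. Let $\mathcal X\subseteq\mathbb R^n$ be closed. Then the maximal robust positively invariant set $\mathcal M$ is nonempty if and only if $\mathcal R\subseteq\mathcal X$.
   Context: Put $\mathcal F(x):=\{Ax+w: A\in\mathscr A,\ w\in\mathcal W\}$. A set $\mathcal S\subseteq\mathbb R^n$ is robust positively invariant if for all $x\in\mathcal S$ one has $\mathcal F(x)\subseteq\mathcal S$ and $x\in\mathcal X$ (the empty set qualifies); the maximal robust positively invariant set $\mathcal M$ is the (existing, unique) robust positively invariant set containing every other one. The family $\mathscr A$ is uniformly exponentially stable if there exist constants $c\ge1$ and $\rho\in[0,1)$ such that $\|A_{k-1}\cdots A_1A_0\|\le c\rho^k$ for every $k\ge1$ and every $A_0,\dots,A_{k-1}\in\mathscr A$, where $\|\cdot\|$ is a fixed matrix norm induced by a vector norm. For $k\ge1$, $\mathfrak B_k(\mathscr A)$ is the set of tuples $\boldsymbol\Psi_k=(\Psi_{k,0},\dots,\Psi_{k,k})$ generated by $A_0,\dots,A_{k-1}\in\mathscr A$ via $\Psi_{k,k}:=I$ and $\Psi_{k,i}:=A_{k-1}A_{k-2}\cdots A_i$ for $0\le i\le k-1$. The $k$-step disturbance-reachable set from the origin is $$\mathcal R_k:=\Big\{\sum_{i=0}^{k-1}\Psi_{k,i+1}w_i:\ \boldsymbol\Psi_k\in\mathfrak B_k(\mathscr A),\ w_0,\dots,w_{k-1}\in\mathcal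 W\Big\},$$ and the limiting disturbance-reachable set is $\mathcal R:=\bigcap_{\ell\ge1}\operatorname{cl}\big(\bigcup_{k\ge\ell}\mathcal R_k\big)$, where $\operatorname{cl}$ denotes closure. *)

(* Defs.v *)
From mathcomp Require Import all_boot all_order all_algebra.
From mathcomp Require Import all_classical all_reals all_analysis.

Set Implicit Arguments.
Unset Strict Implicit.
Unset Printing Implicit Defensive.

Import Order.TTheory GRing.Theory Num.Theory.
Import numFieldNormedType.Exports.

Local Open Scope classical_set_scope.
Local Open Scope ring_scope.

(* Nonnegativity follows from these axioms. *)
Definition vector_norm (R : realType) (n : nat) (N : 'cV[R]_n -> R) : Prop :=
  [/\ forall x y, N (x + y) <= N x + N y,
      forall a x, N (a *: x) = `|a| * N x
    & forall x, N x = 0 -> x = 0].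

(* When N is a vector norm the supremum is over a nonempty bounded set, since
   'cV[R]_n is finite-dimensional. *)
Definition induced_norm (R : realType) (n : nat) (N : 'cV[R]_n -> R)
    (A : 'M[R]_n) : R :=
  sup [set N (A *m x) | x in [set x | N x <= 1]].

Section Dynamics.
Context (R : realType) (n : nat).
Implicit Types (sA : set 'M[R]_n) (W X S : set 'cV[R]_n).

(* A_{k-1} *m ... *m A_i, the later factors on the left; 1%:M for i = k. *)
Definition transition (A : nat -> 'M[R]_n) (k i : nat) : 'M[R]_n :=
  \big[mulmx/1%:M]_(j <- rev (index_iota i k)) A j.

Definition uniformly_exponentially_stable (N : 'cV[R]_n -> R) sA : Prop :=
  exists c rho : R, [/\ 1 <= c, 0 <= rho < 1 &
    forall (k : nat) (A : nat -> 'M[R]_n), (1 <= k)%N ->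
      (forall j, (j < k)%N -> sA (A j)) ->
      induced_norm N (transition A k 0) <= c * rho ^+ k].

(* The values A j with j >= k play no role. *)
Definition transition_tuples sA (k : nat) : set ('I_k.+1 -> 'M[R]_n) :=
  [set Psi | exists A : nat -> 'M[R]_n,
    (forall j, (j < k)%N -> sA (A j)) /\
    (forall i : 'I_k.+1, Psi i = transition A k i)].

(* lift ord0 i is the index i + 1 in 'I_k.+1. *)
Definition reach sA W (k : nat) : set 'cV[R]_n :=
  [set x | exists (Psi : 'I_k.+1 -> 'M[R]_n) (w : 'I_k -> 'cV[R]_n),
    [/\ transition_tuples sA Psi, forall i, W (w i)
      & x = \sum_(i < k) Psi (lift ord0 i) *m w i]].

Definition limit_reach sA W : set 'cV[R]_n :=
  \bigcap_(l in [set l | (1 <= l)%N])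
    closure (\bigcup_(k in [set k | (l <= k)%N]) reach sA W k).

Definition successors sA W (x : 'cV[R]_n) : set 'cV[R]_n :=
  [set y | exists A w, [/\ sA A, W w & y = A *m x + w]].

Definition robust_positively_invariant sA W X S : Prop :=
  forall x, S x -> successors sA W x `<=` S /\ X x.

Definition maximal_rpi sA W X (M : set 'cV[R]_n) : Prop :=
  robust_positively_invariant sA W X M /\
  forall S, robust_positively_invariant sA W X S -> S `<=` M.

Lemma maximal_rpi_exists_unique sA W X : exists! M, maximal_rpi sA W X M.
Proof.
exists (\bigcup_(S in robust_positively_invariant sA W X) S); split.
  split=> [x [S HS Sx]|S HS x Sx]; last by exists S.
  have [FS Xx] := HS x Sx.
  by split=> // y /FS Sy; exists S.
move=> M [HM maxM]; apply/seteqP; split=> [x [S HS Sx]|x Mx].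
  exact: maxM HS x Sx.
by exists M.
Qed.

End Dynamics.

(* Main.v *)
Require Import Defs.
From mathcomp Require Import all_boot all_order all_algebra.
From mathcomp Require Import all_classical all_reals all_analysis.
Import Order.TTheory GRing.Theory Num.Theory.
Import numFieldNormedType.Exports.
Local Open Scope classical_set_scope.
Local Open Scope ring_scope.

(** The set M collects the states all of whose trajectories
    x_(k+1) = A_k x_k + w_k, with A_k in sA and w_k in W, stay in X.  Unrolling
    the recursion gives x_k = Psi_(k,0) x_0 + z_k, where z_k is the trajectory
    issued from the origin under the same choices, that is, an arbitrary point
    of R_k ([trajectoryE], [reachP]).  By uniform exponential stability the
    first term decays geometrically, uniformly in the choices
    ([transition_decay]).

    If M contains some x_0, then for large k every point of R_k is shadowed,
    to arbitrary precision, by a point of M, hence of X.  A point of the limit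
    set is approached by points of R_k with k arbitrarily large; it is
    therefore a limit of points of X, and lies in the closed set X
    ([limit_reach_sub_closed_rpi]).

    Conversely the limit set is stable under every map x |-> A x + w, because
    such a map is continuous and sends R_k into R_(k+1).  So if the limit set
    is contained in X it is robust positively invariant, hence contained in M
    ([limit_reach_rpi]), and it remains to see that it is nonempty.  The
    geometric decay bounds all the R_k at once ([reach_bounded]), and a
    sequence of points z_k in R_k then has a cluster point, which belongs to
    the limit set ([limit_reach_nonempty]).

    Stability is expressed with the operator norm of an arbitrary vector norm
    N, whereas boundedness, closure and compactness refer to the sup norm.  The
    equivalence of the two comes from the compactness of the sup-norm unit
    sphere ([seminorm_le], [vector_norm_ge]); it also makes the supremum
    defining the operator norm finite ([induced_norm_le]). *)

(** * Norms on column vectors *)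

Section Norms.
Context {R : realType} {n : nat}.
Implicit Types (x y : 'cV[R]_n).

Lemma mx_norm_ge_coord m p (A : 'M[R]_(m, p)) i j : `|A i j| <= `|A|.
Proof.
rewrite [leRHS]/Num.Def.normr /= mx_normrE; apply/bigmax_geP; right.
by exists (i, j).
Qed.

Lemma mx_norm_trmx m p (A : 'M[R]_(m, p)) : `|A^T| = `|A|.
Proof.
suff le_tr q r (B : 'M[R]_(q, r)) : `|B^T| <= `|B|.
  by apply/eqP; rewrite eq_le le_tr -{1}[A]trmxK le_tr.
rewrite [leLHS]/Num.Def.normr /= mx_normrE; apply/bigmax_leP.
split=> // -[i j] _ /=.
by rewrite mxE; exact: mx_norm_ge_coord.
Qed.

(** Heine-Borel for column vectors: transposition is an isometry, which
    carries over the statement for row vectors. *)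
Lemma cV_bounded_closed_compact (K : set 'cV[R]_n) :
  bounded_set K -> closed K -> compact K.
Proof.
move=> [M [Mreal Kle]] clK.
have tr_cont m p : continuous (trmx : 'M[R]_(m, p) -> 'M[R]_(p, m)).
  move=> A B /nbhs_ballP[e e0 sB]; apply/nbhs_ballP; exists e => //= C [_ AC].
  by apply: sB; split=> // i j; rewrite !mxE.
have -> : K = trmx @` (trmx @^-1` K : set 'rV[R]_n).
  apply/seteqP; split=> [x Kx|_ [y Ky <-] //].
  by exists x^T; rewrite /= ?trmxK.
apply: continuous_compact.
  by apply: continuous_subspaceT; exact: tr_cont.
apply: bounded_closed_compact.
  exists M; split=> // b Mb y Ky; rewrite /= -mx_norm_trmx; exact: Kle Ky.
by apply: closed_comp => // y _; exact: tr_cont.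
Qed.

Lemma closure_normP (S : set 'cV[R]_n) p :
  closure S p <-> forall e, 0 < e -> exists2 q, S q & `|p - q| < e.
Proof.
split=> [clp e e0|h B /nbhs_ballP[e /= e0 sB]].
  have [q [Sq]] := clp _ (nbhsx_ballx p e e0).
  by rewrite -ball_normE /= => ?; exists q.
have [q Sq pq] := h e e0; exists q; split=> //; apply: sB.
by rewrite -ball_normE.
Qed.

Section Seminorm.
Context {N : 'cV[R]_n -> R}.
Context (ND : forall x y, N (x + y) <= N x + N y).
Context (NZ : forall a x, N (a *: x) = `|a| * N x).

Lemma seminorm0 : N 0 = 0.
Proof. by rewrite -[0](scale0r 0) NZ normr0 mul0r. Qed.

Lemma seminorm_ge0 x : 0 <= N x.
Proof.
have := ND x (- x).
by rewrite subrr seminorm0 -scaleN1r NZ normrN1 mul1r -mulr2n pmulrn_lge0.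
Qed.

(** A seminorm is controlled by its values on the canonical basis.  Applied to
    x |-> N (A x), it also yields the boundedness of a linear map A. *)
Lemma seminorm_le : exists2 C, 0 <= C & forall x, N x <= C * `|x|.
Proof.
exists (\sum_i N (delta_mx i ord0)).
  by apply: sumr_ge0 => i _; exact: seminorm_ge0.
move=> x; rewrite {1}[x]matrix_sum_delta mulr_suml.
under eq_bigr do rewrite big_ord1.
apply: (@le_trans _ _ (\sum_i N (x i ord0 *: delta_mx i ord0))).
  elim/big_ind2: _ => [|a b c d ab cd|//]; first by rewrite seminorm0.
  by apply: le_trans (ND _ _) _; exact: lerD.
apply: ler_sum => i _; rewrite NZ mulrC ler_wpM2l ?seminorm_ge0 //.
exact: mx_norm_ge_coord.
Qed.

Lemma seminorm_continuous : continuous N.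
Proof.
have [C C0 NC] := seminorm_le.
have NB x y : N x - N y <= C * `|x - y|.
  rewrite lerBlDr; apply: le_trans (lerD (NC _) (lexx _)).
  by rewrite -{1}(subrK y x).
(* C may vanish, so the modulus of continuity uses C + 1. *)
have C1 : 0 < C + 1 by rewrite ltr_wpDl.
move=> x B /nbhs_ballP[e /= e0 sB]; apply/nbhs_ballP.
exists (e / (C + 1)) => [|y]; first exact: divr_gt0.
rewrite -ball_normE /= ltr_pdivlMr // mulrC => xy.
apply: sB; rewrite -ball_normE /=; apply: le_lt_trans xy.
apply: (@le_trans _ _ (C * `|x - y|)); last by rewrite ler_wpM2r // lerDl.
by rewrite ler_norml NB andbT -lerN2 opprK opprB distrC NB.
Qed.

End Seminorm.

(** The other half of norm equivalence: N attains its minimum on the compact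
    sup-norm unit sphere, and definiteness makes this minimum positive. *)
Lemma vector_norm_ge {N : 'cV[R]_n -> R} :
  vector_norm N -> exists2 C, 0 <= C & forall x, `|x| <= C * N x.
Proof.
move=> [ND NZ N0].
pose S := [set x : 'cV[R]_n | `|x| = 1].
(* The sphere is empty exactly when n = 0. *)
have [[x0 Sx0]|S0] := pselect (S !=set0); last first.
  exists 0 => // x; rewrite mul0r.
  have [->|x_neq0] := eqVneq x 0; first by rewrite normr0.
  by case: S0; exists (`|x|^-1 *: x); rewrite /S /= normfZV.
have cS : compact S.
  apply: cV_bounded_closed_compact.
    by exists 1; split=> // b /ltW b1 x Sx; rewrite /= Sx.
  rewrite (_ : S = (fun x => `|x|) @^-1` [set 1 : R]) //.
  apply: closed_comp => [x _|]; first exact: norm_continuous.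
  exact: closed_eq.
have [y /set_mem Sy ymin] := compact_EVT_min (ex_intro _ _ Sx0) cS
  (continuous_subspaceT (seminorm_continuous ND NZ)).
have Ny : 0 < N y.
  rewrite lt_neqAle seminorm_ge0 // andbT eq_sym; apply/eqP => /N0 y0.
  by move: Sy; rewrite /S /= y0 normr0 => /esym/eqP; rewrite oner_eq0.
exists (N y)^-1 => [|x]; first by rewrite invr_ge0 ltW.
have [->|x_neq0] := eqVneq x 0; first by rewrite normr0 seminorm0 ?mulr0.
rewrite ler_pdivlMl // mulrC -ler_pdivlMl ?normr_gt0 //.
rewrite -[X in X * _]ger0_norm ?invr_ge0 // -NZ.
by apply: ymin; rewrite inE /S /= normfZV.
Qed.

(** The supremum is an upper bound only because its set is bounded, and this
    needs both halves of norm equivalence: the N-unit ball is bounded in the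
    sup norm, and x |-> N (A x) is bounded by a multiple of the sup norm. *)
Lemma induced_norm_le (N : 'cV[R]_n -> R) (A : 'M[R]_n) x :
  vector_norm N -> N (A *m x) <= induced_norm N A * N x.
Proof.
move=> vN; have [ND NZ N0] := vN.
have [C C0 xC] := vector_norm_ge vN.
have [|a y|D D0 AD] := @seminorm_le (fun x => N (A *m x)).
- by move=> y z; rewrite mulmxDr.
- by rewrite -scalemxAr.
have [->|x_neq0] := eqVneq x 0; first by rewrite mulmx0 seminorm0 ?mulr0.
have Nx : 0 < N x.
  rewrite lt_neqAle seminorm_ge0 // andbT eq_sym.
  by apply: contra_neq x_neq0 => /N0.
rewrite -ler_pdivrMr // mulrC -[X in X * _]gtr0_norm ?invr_gt0 // -NZ scalemxAr.
apply: sup_upper_bound.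
  split.
    by exists (N (A *m 0)); exists 0 => //=; rewrite seminorm0 ?ler01.
  exists (D * C) => _ [y /= Ny <-]; apply: le_trans (AD y) _.
  rewrite ler_wpM2l //; apply: le_trans (xC y) _.
  by rewrite -[leRHS]mulr1 ler_wpM2l.
by exists ((N x)^-1 *: x) => //=; rewrite NZ gtr0_norm ?invr_gt0 // mulVf ?gt_eqF.
Qed.

End Norms.

(** * Transition matrices and trajectories *)

Section Trajectories.
Context {R : realType} {n : nat}.
Implicit Types (A : nat -> 'M[R]_n) (w : nat -> 'cV[R]_n) (x : 'cV[R]_n).
Implicit Types (sA : set 'M[R]_n) (W X S : set 'cV[R]_n) (k : nat).

Lemma transition_id A k : transition A k k = 1%:M.
Proof. by rewrite /transition /index_iota subnn big_nil. Qed.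

Lemma transitionS A k i :
  (i <= k)%N -> transition A k.+1 i = A k *m transition A k i.
Proof.
move=> ik; rewrite /transition /index_iota subSn // -addn1 iotaD rev_cat /=.
by rewrite big_cons subnKC.
Qed.

Lemma transition_shift A k i :
  transition A k i = transition (fun j => A (i + j)%N) (k - i) 0.
Proof.
rewrite /transition /index_iota subn0 -[X in iota X _]addn0 iotaDl -map_rev.
by rewrite big_map.
Qed.

(** Stability bounds only the products that start at time 0, in the operator
    norm.  The family sA does not depend on time, so a product starting at time
    i is one starting at 0 for the shifted sequence of matrices; norm
    equivalence then gives the estimate in the sup norm. *)
Lemma transition_decay {N : 'cV[R]_n -> R} {sA} :
  vector_norm N -> uniformly_exponentially_stable N sA ->
  exists C rho : R, [/\ 0 <= C, 0 <= rho < 1 &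
    forall A k, (forall j, (j < k)%N -> sA (A j)) -> forall i x, (i <= k)%N ->
      `|transition A k i *m x| <= C * rho ^+ (k - i) * `|x|].
Proof.
move=> vN [c [rho [c1 rho01 stab]]]; have [ND NZ _] := vN.
have [rho0 _] := andP rho01.
have [D D0 leD] := vector_norm_ge vN; have [B B0 leB] := seminorm_le ND NZ.
have c0 : 0 <= c by apply: le_trans c1.
(* The maximum with 1 accounts for the empty product, k = i. *)
exists (Num.max 1 (D * c * B)), rho; split=> //; first by rewrite le_max ler01.
move=> A k sAA i x; rewrite leq_eqVlt => /predU1P[->|ik].
  by rewrite transition_id mul1mx subnn mulr1 ler_peMl // le_max lexx.
apply: (@le_trans _ _ (D * c * B * rho ^+ (k - i) * `|x|)); last first.
  by rewrite !ler_wpM2r ?exprn_ge0 // le_max lexx orbT.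
apply: le_trans (leD _) _; rewrite -!mulrA ler_wpM2l //.
have leI := induced_norm_le N (transition A k i) x vN.
apply: le_trans leI _.
apply: (@le_trans _ _ (c * rho ^+ (k - i) * N x)).
  rewrite ler_wpM2r ?seminorm_ge0 // transition_shift.
  apply: stab => [|j jki]; first by rewrite subn_gt0.
  by apply: sAA; rewrite -ltn_subRL.
rewrite -mulrA ler_wpM2l // mulrCA ler_wpM2l ?exprn_ge0 //.
Qed.

Fixpoint trajectory A w x k : 'cV[R]_n :=
  if k is k'.+1 then A k' *m trajectory A w x k' + w k' else x.

Lemma trajectoryE A w x k : trajectory A w x k =
  transition A k 0 *m x + \sum_(i < k) transition A k i.+1 *m w i.
Proof.
elim: k => [|k IH] /=; first by rewrite transition_id mul1mx big_ord0 addr0.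
rewrite IH big_ord_recr /= transition_id mul1mx transitionS // addrA.
rewrite mulmxDr mulmxA mulmx_sumr; congr (_ + _ + _).
by apply: eq_bigr => i _; rewrite transitionS // mulmxA.
Qed.

Lemma eq_trajectory A A' w w' x k :
  (forall j, (j < k)%N -> A j = A' j /\ w j = w' j) ->
  trajectory A w x k = trajectory A' w' x k.
Proof.
elim: k => //= k IH eqAw; have [-> ->] := eqAw k (ltnSn k).
by rewrite IH // => j jk; apply: eqAw; rewrite ltnW.
Qed.

(** Trajectories from the origin are easier to extend by one step than the sums
    over transition tuples that define the reachable sets. *)
Lemma reachP sA W k x : reach sA W k x <-> exists A w,
  (forall j, (j < k)%N -> sA (A j) /\ W (w j)) /\ x = trajectory A w 0 k.
Proof.
split=> [[Psi [w [[A [sAA PsiE]] Ww ->]]]|[A [w [Aw ->]]]].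
  exists A, (fun j => if insub j is Some i then w i else 0); split.
    by move=> j jk; split; [exact: sAA|rewrite insubT].
  rewrite trajectoryE mulmx0 add0r; apply: eq_bigr => i _.
  by rewrite PsiE lift0 valK.
exists (fun i : 'I_k.+1 => transition A k i), (fun i : 'I_k => w i); split.
- by exists A; split=> // j /Aw[].
- by move=> i; have [] := Aw i (ltn_ord i).
- rewrite trajectoryE mulmx0 add0r; apply: eq_bigr => i _.
  by rewrite lift0.
Qed.

Lemma reach_nonempty sA W k : sA !=set0 -> W !=set0 -> reach sA W k !=set0.
Proof.
move=> [A0 sAA] [w0 Ww]; exists (trajectory (fun=> A0) (fun=> w0) 0 k).
by apply/reachP; exists (fun=> A0), (fun=> w0).
Qed.

Lemma reachS sA W k x (A : 'M[R]_n) (w : 'cV[R]_n) :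
  sA A -> W w -> reach sA W k x -> reach sA W k.+1 (A *m x + w).
Proof.
move=> sAA Ww /reachP[B [v [Bv ->]]]; apply/reachP.
exists (fun j => if (j < k)%N then B j else A),
       (fun j => if (j < k)%N then v j else w); split=> [j _|/=].
  by case: ifPn => // /Bv.
by rewrite ltnn; congr (_ *m _ + _); apply: eq_trajectory => j ->.
Qed.

Lemma robust_positively_invariant_trajectory {sA W X S A w x k} :
  robust_positively_invariant sA W X S ->
  (forall j, (j < k)%N -> sA (A j) /\ W (w j)) ->
  S x -> S (trajectory A w x k).
Proof.
move=> rpiS + Sx; elim: k => //= k IH Aw; have [sAA Ww] := Aw k (ltnSn k).
have /rpiS[succS _] : S (trajectory A w x k).
  by apply: IH => j jk; apply: Aw; rewrite ltnW.
by apply: succS; exists (A k), (w k).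
Qed.

End Trajectories.

(** * The limiting reachable set *)

Section LimitReach.
Context {R : realType} {n : nat}.
Context {N : 'cV[R]_n -> R} {sA : set 'M[R]_n} {W : set 'cV[R]_n}.
Context (normN : vector_norm N).
Context (stableA : uniformly_exponentially_stable N sA).

Lemma limit_reachP p : limit_reach sA W p <->
  forall l e, 0 < e ->
    exists k q, [/\ (l <= k)%N, reach sA W k q & `|p - q| < e].
Proof.
split=> [Lp l e e0|h l _].
  have /closure_normP/(_ e e0)[q [k /= lk Rq] pq] := Lp l.+1 isT.
  by exists k, q; split=> //; exact: ltnW.
apply/closure_normP => e e0; have [k [q [lk Rq pq]]] := h l e e0.
by exists q => //; exists k.
Qed.

(** The trajectory from a point of S and the trajectory from the origin, under
    the same matrices and disturbances, differ by a transition matrix applied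
    to the initial point, so the former shadows the latter at large times. *)
Lemma limit_reach_sub_closed_rpi {X S} :
  closed X -> robust_positively_invariant sA W X S -> S !=set0 ->
  limit_reach sA W `<=` X.
Proof.
move=> clX rpiS [x Sx] p /limit_reachP Lp.
have [C [rho [C0 /andP[rho0 rho1] decay]]] := transition_decay normN stableA.
apply: clX; apply/closure_normP => e e0.
have e20 : 0 < e / 2 by rewrite divr_gt0.
have /cvgrPdist_lt/(_ _ e20)[l _ small] :
    C * rho ^+ k * `|x| @[k --> \oo] --> (0 : R).
  rewrite -(mul0r `|x|) -(mulr0 C); apply: cvgM; last exact: cvg_cst.
  by apply: cvgM; [exact: cvg_cst|apply: cvg_expr; rewrite ger0_norm].
have [k [q [lk /reachP[A [w [Aw ->]]] pq]]] := Lp l _ e20.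
exists (trajectory A w x k).
  exact: (rpiS _ (robust_positively_invariant_trajectory rpiS Aw Sx)).2.
rewrite -(subrKA (trajectory A w 0 k)) (splitr e).
apply: le_lt_trans (ler_normD _ _) _; apply: ltrD => //.
rewrite distrC !trajectoryE mulmx0 add0r addrK.
apply: le_lt_trans (decay _ _ _ _ _ (leq0n k)) _ => [j /Aw[]//|].
rewrite subn0; have := small k lk.
by rewrite sub0r normrN ger0_norm // !mulr_ge0 ?exprn_ge0.
Qed.

(** The contributions of the successive disturbances are dominated by a
    geometric series, whose sum does not depend on k. *)
Lemma reach_bounded : bounded_set W ->
  exists B, forall k x, reach sA W k x -> `|x| <= B.
Proof.
move=> /ex_strict_bound_gt0[b b0 Wb].
have [C [rho [C0 /andP[rho0 rho1] decay]]] := transition_decay normN stableA.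
exists (C * b / (1 - rho)) => k _ /reachP[A [w [Aw ->]]].
rewrite trajectoryE mulmx0 add0r; apply: le_trans (ler_norm_sum _ _ _) _.
apply: (@le_trans _ _ (\sum_(i < k) C * b * rho ^+ (k - i.+1))).
  apply: ler_sum => i _; apply: le_trans (decay _ _ _ _ _ _) _ => //.
    by move=> j /Aw[].
  rewrite mulrAC ler_wpM2r ?exprn_ge0 // ler_wpM2l //.
  by apply: ltW; apply: Wb; have [] := Aw i (ltn_ord i).
rewrite -mulr_sumr ler_wpM2l ?mulr_ge0 ?(ltW b0) //.
rewrite -[leRHS]mul1r ler_pdivlMr ?subr_gt0 //.
rewrite (reindex_inj rev_ord_inj) /=.
under eq_bigr => i _ do rewrite subnSK // subKn 1?ltnW //.
rewrite mulrC -opprB mulNr -subrX1 opprB lerBlDr lerDl.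
exact: exprn_ge0.
Qed.

Lemma limit_reach_nonempty : sA !=set0 -> W !=set0 -> bounded_set W ->
  limit_reach sA W !=set0.
Proof.
move=> sA0 W0 /reach_bounded[B reachB].
have /choice[z Rz] : forall k, exists z, reach sA W k z.
  by move=> k; exact: reach_nonempty.
pose K := [set x : 'cV[R]_n | `|x| <= B].
have cK : compact K.
  apply: cV_bounded_closed_compact.
    by exists B; split=> [|b /ltW Bb x Kx]; [exact: num_real|exact: le_trans Bb].
  rewrite (_ : K = (fun x => `|x|) @^-1` [set y : R | y <= B]) //.
  by apply: closed_comp => [x _|]; [exact: norm_continuous|exact: closed_le].
have [|p [_ zp]] := cK (z @ \oo) _.
  by exists 0%N => // k _; exact: reachB (Rz k).
exists p => l _ U pU; apply: zp => //.
by exists l => // k lk; exists k.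
Qed.

(** One step of the dynamics is Lipschitz and maps R_k into R_(k+1), so an
    approximation of p at a late time gives one of A p + w at the next time. *)
Lemma limit_reach_rpi {X} : limit_reach sA W `<=` X ->
  robust_positively_invariant sA W X (limit_reach sA W).
Proof.
move=> LX p Lp; split; last exact: LX.
move=> _ [A [w [sAA Ww ->]]]; apply/limit_reachP => l e e0.
have [|a x|D D0 AD] := @seminorm_le R n (fun x => `|A *m x|).
- by move=> x y; rewrite mulmxDr; exact: ler_normD.
- by rewrite -scalemxAr normrZ.
have D1 : 0 < D + 1 by rewrite ltr_wpDl.
have [|k [q [lk Rq pq]]] := (limit_reachP p).1 Lp l (e / (D + 1)).
  exact: divr_gt0.
exists k.+1, (A *m q + w); split; [exact: ltnW|exact: reachS|].
rewrite opprD addrACA subrr addr0 -mulmxBr; apply: le_lt_trans (AD _) _.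
apply: (@le_lt_trans _ _ ((D + 1) * `|p - q|)).
  by rewrite ler_wpM2r // lerDl.
by rewrite mulrC -ltr_pdivlMr.
Qed.

End LimitReach.

Theorem theorem4 (R : realType) (n : nat) (N : 'cV[R]_n -> R)
    (sA : set 'M[R]_n) (W X M : set 'cV[R]_n) :
  vector_norm N ->
  sA !=set0 ->
  uniformly_exponentially_stable N sA ->
  W !=set0 ->
  bounded_set W ->
  closed X ->
  maximal_rpi sA W X M ->
  (M !=set0 <-> limit_reach sA W `<=` X).
Proof.
move=> normN sA0 stableA W0 bW clX [rpiM maxM]; split=> [M0|LX].
  exact (limit_reach_sub_closed_rpi normN stableA clX rpiM M0).
have [p Lp] := limit_reach_nonempty normN stableA sA0 W0 bW.
by exists p; apply: maxM Lp; exact: limit_reach_rpi.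
Qed.
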